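(* Let $\alpha,\beta,r>0$ and $0<p<1$. Let $Y_\alpha\sim\mathcal{G}a(\alpha)$ and $Y_i\sim\mathcal{G}a(1)$, $i=1,2,\dots$, be mutually independent, and let $X_i=\beta\,Y_i/Y_\alpha$ for $i\ge 1$. Let $N$ be a negative binomial random variable with $$\Pr(N=n)=\frac{\Gamma(n+r)}{\Gamma(n+1)\Gamma(r)}p^r(1-p)^n,\quad n=0,1,2,\dots,$$ independent of $(X_i)_{i\ge1}$, and let $S_N=X_1+\dots+X_N$ (with $S_N=0$ if $N=0$). Then the distribution of $S_N$ has an atom at $0$ of mass $\Pr(S_N=0)=p^r$, and on $(0,\infty)$ it has density $$f_{S_N}(x;\alpha,\beta,r,p)=\frac{r\alpha(1-p)p^r}{\beta(1+x/\beta)^{\alpha+1}}\;{}_2F_1\left[1+r,1+\alpha;2;\frac{(1-p)x/\beta}{1+x/\beta}\right],\quad x>0.$$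
   Context: For $a>0$, $\mathcal{G}a(a)$ denotes the gamma distribution with probability density function $x^{a-1}e^{-x}/\Gamma(a)$ for $x>0$. ${}_2F_1[a,b;c;z]=\sum_{n=0}^\infty\frac{(a)_n(b)_n z^n}{(c)_n n!}$ is the Gauss hypergeometric function, where $(a)_n=a(a+1)\cdots(a+n-1)$, $(a)_0=1$, is the rising Pochhammer symbol. *)

(* Defs.v *)
From HB Require Import structures.
From mathcomp Require Import all_boot all_order all_algebra.
From mathcomp Require Import all_classical all_reals all_analysis measurable_realfun.

Set Implicit Arguments.
Unset Strict Implicit.
Unset Printing Implicit Defensive.

Import Order.TTheory GRing.Theory Num.Theory.
Import numFieldNormedType.Exports.

Local Open Scope classical_set_scope.
Local Open Scope ring_scope.

Section special_functions.
Context {R : realType}.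
Implicit Types a b c x z : R.

Definition Gamma a : R :=
  (\int[lebesgue_measure]_(x in `]0, +oo[) (x `^ (a - 1) * expR (- x)))%R.

Definition gamma_pdf a : R -> R :=
  (fun x => x `^ (a - 1) * expR (- x) / Gamma a) \_ `]0, +oo[.

Definition pochhammer a (n : nat) : R := \prod_(i < n) (a + i%:R).

Definition hyp2F1_coeff a b c z : R^nat := fun n =>
  pochhammer a n * pochhammer b n * z ^+ n / (pochhammer c n * n`!%:R).

(* The Gauss series converges for |z| < 1; [limn] carries no meaning elsewhere. *)
Definition hyp2F1 a b c z : R := limn (series (hyp2F1_coeff a b c z)).

Definition negbin_pmf (r p : R) (n : nat) : R :=
  Gamma (n%:R + r) / (Gamma (n%:R + 1) * Gamma r) * p `^ r * (1 - p) ^+ n.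

End special_functions.

Section probability_notions.
Context d (T : measurableType d) (R : realType) (P : probability T R).

(* The law of X restricted to D has density f; the mass of X outside D is not
   constrained. *)
Definition has_density_on (X : {RV P >-> R}) (D : set R) (f : R -> R) : Prop :=
  [/\ measurable_fun D f,
      forall x, D x -> 0 <= f x
    & forall A, measurable A -> A `<=` D ->
        distribution P X A = (\int[lebesgue_measure]_(x in A) (f x)%:E)%E].

Definition gamma_distributed (a : R) (X : {RV P >-> R}) : Prop :=
  has_density_on X setT (gamma_pdf a).

Definition mutually_independent (I : eqType) (X : I -> {RV P >-> R}) : Prop :=
  forall (s : seq I) (A : I -> set R), uniq s ->
    (forall i, measurable (A i)) ->
    P (\bigcap_(i in [set` s]) X i @^-1` A i)
      = (\prod_(i <- s) P (X i @^-1` A i))%E.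

(* The sigma-algebra generated by the whole family X. *)
Definition sigma_family (I : Type) (X : I -> {RV P >-> R}) : set (set T) :=
  <<s \bigcup_(i in [set: I]) preimage_set_system setT (X i) measurable >>.

Definition independent_of_family (N : {RV P >-> nat}) (I : Type)
    (X : I -> {RV P >-> R}) : Prop :=
  forall (B : set nat) (E : set T), measurable B -> sigma_family X E ->
    P (N @^-1` B `&` E) = (P (N @^-1` B) * P E)%E.

End probability_notions.

Lemma measurable_inv {R : realType} : measurable_fun [set: R] (@GRing.inv R).
Proof.
have mC0 : measurable (~` [set 0 : R]) by exact: measurableC.
rewrite -(setUv [set 0 : R]); apply/measurable_funU => //; split.
  exact: measurable_fun_set1.
apply: open_continuous_measurable_fun.
  by rewrite openC; exact/accessible_closed_set1/hausdorff_accessible/Rhausdorff.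
move=> x; rewrite inE /= => x0; apply: inv_continuous; exact/eqP.
Qed.

Section scaled_ratio.
Context d (T : measurableType d) (R : realType) (P : probability T R).
Variables (b : R) (Y Z : {RV P >-> R}).

(* Since 0^-1 = 0, the value is 0 where Z w = 0. *)
Definition scaled_ratio (w : T) : R := b * Y w / Z w.

Lemma measurable_scaled_ratio : measurable_fun setT scaled_ratio.
Proof.
apply: measurable_funM; first exact: measurable_funM.
by apply: (measurableT_comp measurable_inv).
Qed.

HB.instance Definition _ :=
  isMeasurableFun.Build _ _ _ _ scaled_ratio measurable_scaled_ratio.

End scaled_ratio.

Section random_sum.
Context d (T : measurableType d) (R : realType) (P : probability T R).
Variables (N : {RV P >-> nat}) (X : nat -> {RV P >-> R}).

(* The summands are indexed from 0: X 0, X 1, .. are the X_1, X_2, .. of the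
   usual notation S_N = X_1 + .. + X_N. *)
Definition random_sum (w : T) : R := \sum_(i < N w) X i w.

Lemma measurable_random_sum : measurable_fun setT random_sum.
Proof.
move=> _ A mA; rewrite setTI.
rewrite (_ : _ @^-1` A = \bigcup_n (N @^-1` [set n] `&`
    (fun w => \sum_(i < n) X i w) @^-1` A)); last first.
  apply/seteqP; split => [w Aw|w [n _ [/= <-]]//].
  by exists (N w).
apply: bigcup_measurable => n _; apply: measurableI.
  exact: measurable_funPTI.
rewrite -[X in measurable X]setTI.
by apply: measurable_sum.
Qed.

HB.instance Definition _ :=
  isMeasurableFun.Build _ _ _ _ random_sum measurable_random_sum.

End random_sum.

(* Main.v *)
Require Import Defs.
From mathcomp Require Import all_boot all_order all_algebra.
From mathcomp Require Import all_classical all_reals all_analysis.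
From mathcomp Require Import measurable_realfun ring lra.

Set Implicit Arguments.
Unset Strict Implicit.
Unset Printing Implicit Defensive.

Import Order.TTheory GRing.Theory Num.Theory.
Import numFieldNormedType.Exports.

Local Open Scope classical_set_scope.
Local Open Scope ring_scope.

(* Given N = n >= 1, S_n = beta G_n / Y_alpha where G_n = Y_1 + .. + Y_n is a
   gamma variable of parameter n independent of Y_alpha, so S_n has the beta
   prime density
     Gamma (n + alpha) / (Gamma n Gamma alpha)
       * x^(n-1) beta^(-n) (1 + x/beta)^(-(n + alpha)).
   Weighted by the negative binomial masses, the density for n + 1 is the n-th
   term of the Gauss series 2F1[1 + r, 1 + alpha; 2; z] at
   z = (1 - p) (x/beta) / (1 + x/beta), up to the prefactor of the statement. *)

(** * Affine changes of variables for the Lebesgue integral *)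

(** Two obstacles shape the proof. [Gamma] is the finite part of an extended integral, hence 0
    whenever that integral is infinite, and its positivity has to come from somewhere: here it comes
    from the laws themselves, whose densities or masses would all vanish if the normalising constant
    were 0. The integral identities are accordingly kept in the extended reals for nonnegative
    integrands, where Tonelli and monotone convergence apply without integrability.

    The summands share the denominator Y_alpha and are dependent, so independence is exploited on
    the numerators: their sum is compared with the single denominator. That sum grows by one
    exponential variable at a time, which reduces each convolution to the integral of u^(a-1) over
    (0, t). The same integral gives the recursion of the gamma function, so the beta integral never
    has to be computed. *)

Section lebesgue_affine.
Context {R : realType}.
Notation mu := (@lebesgue_measure R).
Local Open Scope ereal_scope.

(** The pushforward of [mu] under the affine map, scaled by [c], gives half-open intervals their
    length, and this determines Lebesgue measure. *)
Lemma lebesgue_measure_affine (c t : R) (A : set R) : (0 < c)%R ->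
  measurable A -> mu A = c%:E * mu ((fun x => c * x + t)%R @^-1` A).
Proof.
move=> c0 mA.
pose k : {nonneg R} := NngNum (ltW c0).
pose phi : R -> measurableTypeR R := fun x => (c * x + t)%R.
have mphi : measurable_fun setT phi.
  by apply: measurable_funD => //; apply: measurable_funM.
pose m : {measure set (measurableTypeR R) -> \bar R} :=
  measure_function_pushforward__canonical__measure_function_Measure mu mphi.
rewrite (lebesgue_measure_unique (mu := mscale k m)) //.
move=> _ [[a b]] _ <- /=; rewrite /mscale /m /= /pushforward.
rewrite (_ : phi @^-1` `]a, b] = `](a - t) / c, (b - t) / c]%classic)%R;
  last first.
  apply/seteqP; split=> x /=; rewrite !in_itv/= ltr_pdivrMr// ler_pdivlMr//;
    by rewrite /phi ltrBlDr lerBrDr (mulrC x).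
rewrite !lebesgue_measure_itv/= !lte_fin ltr_pM2r ?invr_gt0// ltrD2r.
case: ifPn => _; last by rewrite mule0.
by rewrite -!EFinB -EFinM; congr (_%:E); field; rewrite gt_eqF.
Qed.

Lemma ge0_integral_affine (c t : R) (f : R -> \bar R) : (0 < c)%R ->
  measurable_fun setT f -> (forall x, 0 <= f x) ->
  \int[mu]_x f x = c%:E * \int[mu]_x f (c * x + t)%R.
Proof.
move=> c0 mf f0.
pose k : {nonneg R} := NngNum (ltW c0).
pose phi : R -> measurableTypeR R := fun x => (c * x + t)%R.
have mphi : measurable_fun setT phi.
  by apply: measurable_funD => //; apply: measurable_funM.
pose m : {measure set (measurableTypeR R) -> \bar R} :=
  measure_function_pushforward__canonical__measure_function_Measure mu mphi.
rewrite (@eq_measure_integral _ _ _ _ (mscale k m)); last first.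
  by move=> A mA _; exact: (lebesgue_measure_affine t c0 mA).
rewrite ge0_integral_mscale//; congr (_ * _).
by rewrite [LHS]ge0_integral_pushforward// preimage_setT.
Qed.

End lebesgue_affine.

(** * Improper integrals of powers and of the exponential *)

Section power_integral.
Context {R : realType}.
Notation mu := (@lebesgue_measure R).

Lemma measurable_fun_gt0_if (h : R -> R) : measurable_fun setT h ->
  measurable_fun setT (fun x : R => if 0 < x then h x else 0).
Proof.
move=> mh; apply: measurable_fun_ifT => //.
by apply: measurable_fun_ltr.
Qed.

Lemma powR_exprn (b a : R) n : 0 <= b -> (b ^+ n) `^ a = (b `^ a) ^+ n.
Proof.
move=> b0.
by rewrite -(powR_mulrn n b0) -(powR_mulrn n (powR_ge0 b a)) -!powRrM mulrC.
Qed.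

(** For [a < 1] the integrand is unbounded at 0. The fundamental theorem of calculus is therefore
    applied on compact intervals shrinking away from 0, and monotone convergence fills []0, t]]. *)
Lemma integral_powR (a t : R) : 0 < a -> 0 < t ->
  (\int[mu]_x (if 0 < x < t then a * x `^ (a - 1) else 0)%:E = (t `^ a)%:E)%E.
Proof.
move=> a0 t0.
have mpow : measurable_fun setT (fun x : R => a * x `^ (a - 1)).
  by apply: measurable_funM => //; exact: measurable_powR.
(* The exponent [n.+1] keeps the left endpoint strictly below [t] already for [n = 0], as the
   fundamental theorem requires. *)
pose F n := `[t * 2^-1 ^+ n.+1, t]%classic.
have h1 : (2^-1 : R) < 1 by rewrite invf_lt1 ?ltr1n.
have ht n : t * 2^-1 ^+ n.+1 < t.
  by rewrite gtr_pMr// exprn_ilt1// ltW.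
have hp n : 0 < t * 2^-1 ^+ n by rewrite mulr_gt0// exprn_gt0.
have h10 : 0 < (2^-1 : R) by [].
have cvg0 (b : R) : 0 < b -> b < 1 -> (b ^+ n.+1 @[n --> \oo] --> 0)%classic.
  move=> b0 b1; rewrite (cvg_shiftS (fun n => b ^+ n)).
  by apply: cvg_expr; rewrite ger0_norm ?ltW.
have UF : \bigcup_n F n = `]0, t]%classic.
  apply/seteqP; split => [x [n _]|x]; rewrite /F /= !in_itv/= => /andP[x0 xt].
    by rewrite xt andbT (lt_le_trans _ x0).
  have /cvgrPdist_lt/(_ (x / t))[|n _ Hn] := cvg0 2^-1 h10 h1.
    by rewrite divr_gt0.
  exists n => //; rewrite /F /= in_itv/= xt andbT.
  have /= := Hn n (leqnn n); rewrite sub0r normrN ger0_norm; last first.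
    by rewrite exprn_ge0// ltW.
  by move=> nx; apply: ltW; move: nx; rewrite ltr_pdivlMr// mulrC.
transitivity (\int[mu]_(x in `]0%R, t]%classic) (a * x `^ (a - 1))%:E)%E.
  rewrite [LHS](_ : _ = \int[mu]_(x in `]0%R, t[) (a * x `^ (a - 1))%:E)%E;
    last first.
    rewrite [RHS]integral_mkcond; apply: eq_integral => x _.
    by rewrite patchE mem_setE in_itv/=; case: ifP.
  apply: integral_itv_bndo_bndc.
  exact/measurable_EFinP/measurable_funTS.
have cvg1 : (\int[mu]_(x in F n) (a * x `^ (a - 1))%:E @[n --> \oo]
    --> \int[mu]_(x in `]0%R, t]) (a * x `^ (a - 1))%:E)%E.
  rewrite -UF; apply: ge0_nondecreasing_set_cvg_integral => //.
  - apply/nondecreasing_seqP => n; apply/subsetPset => x.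
    rewrite /F /= !in_itv/= => /andP[x0 ->]; rewrite andbT (le_trans _ x0)//.
    by rewrite ler_pM2l// ler_wiXn2l// ltW.
  - by move=> i; exact: measurable_itv.
  - by move=> i; exact/measurable_EFinP/measurable_funTS.
  - by move=> i x _; rewrite lee_fin mulr_ge0 ?powR_ge0 ?ltW//.
have FE n : (\int[mu]_(x in F n) (a * x `^ (a - 1))%:E =
    (t `^ a - t `^ a * (2^-1 `^ a) ^+ n.+1)%:E)%E.
  rewrite (@continuous_FTC2 R _ (fun x : R => x `^ a)) //.
  - rewrite -EFinB powRM ?exprn_ge0 ?ltW//; congr (_ - _ * _)%:E.
    by rewrite powR_exprn// ltW.
  - apply: derivable_within_continuous => x; rewrite in_itv/= => /andP[x0 _].
    have {}x0 : 0 < x by rewrite (lt_le_trans _ x0).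
    have [] := is_derive1_powR (a - 1) x0.
    by move=> dx _; apply: (derivableM _ dx); exact: derivable_cst.
  - have dpow (x : R) : 0 < x -> derivable (fun x : R => x `^ a) x 1.
      by move=> x0; have [] := is_derive1_powR a x0.
    have cpow (x : R) : 0 < x -> {for x, continuous (fun x : R => x `^ a)}.
      by move=> x0; apply/differentiable_continuous/derivable1_diffP/dpow.
    split.
    + by move=> x; rewrite in_itv/= => /andP[x0 _]; apply: dpow;
      rewrite (lt_trans _ x0).
    + by apply: cvg_at_right_filter; exact: cpow.
    + by apply: cvg_at_left_filter; exact: cpow.
  - move=> x; rewrite in_itv/= => /andP[x0 _].
    by rewrite powR_derive1// in_itv/= andbT (lt_trans _ x0).
have cvg2 : (\int[mu]_(x in F n) (a * x `^ (a - 1))%:E @[n --> \oo] --> (t `^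
  a)%:E)%E.
  under eq_fun do rewrite FE.
  apply: cvg_EFin; first exact: nearW.
  rewrite -[X in _ --> X]subr0; apply: cvgB; first exact: cvg_cst.
  rewrite -[X in _ --> X](mulr0 (t `^ a)); apply: cvgMr; apply: cvg0.
    by rewrite powR_gt0.
  by rewrite /powR gt_eqF// expR_lt1 pmulr_rlt0// ln_lt0// h10 h1.
exact: (cvg_unique _ cvg1 cvg2).
Qed.

Lemma integral_expRN_tail (x : R) :
  (\int[mu]_t (if x < t then expR (- t) else 0)%:E = (expR (- x))%:E)%E.
Proof.
rewrite [LHS](_ : _ = \int[mu]_(t in `]x, +oo[%classic) (expR (- t))%:E)%E;
  last first.
  rewrite [RHS]integral_mkcond; apply: eq_integral => t _.
  by rewrite patchE mem_setE in_itv/= andbT; case: ifP.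
have mexp : measurable_fun setT (fun t : R => expR (- t)).
  exact: measurableT_comp.
have cexp : continuous (fun t : R => expR (- t)).
  by move=> t; apply: continuous_comp;
    [exact: opp_continuous|exact: continuous_expR].
rewrite integral_itv_obnd_cbnd; last exact/measurable_EFinP/measurable_funTS.
rewrite (@ge0_continuous_FTC2y _ _ (fun t => - expR (- t)) _ 0) ?sub0e ?oppeK//.
- by rewrite EFinN oppeK.
- by apply: continuous_subspaceT.
- by rewrite -oppr0; apply: cvgN; exact: cvgr_expR.
- by apply: cvgN; apply: cvg_at_right_filter; exact: cexp.
- move=> t _; rewrite derive1E deriveN//.
  by rewrite -derive1E derive1_comp// derive1N// derive1_id derive1E derive_val
    mulrN1 opprK.
Qed.

End power_integral.

(** * The gamma function *)

Section gamma_function.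
Context {R : realType}.
Notation mu := (@lebesgue_measure R).
Implicit Types a c x : R.

(** Extending the integrand by 0 lets every integral run over the whole line, where Tonelli and the
    affine substitutions are stated. *)
Definition gamma_kernel (a x : R) : R :=
  if 0 < x then x `^ (a - 1) * expR (- x) else 0.

Lemma gamma_kernel_ge0 a x : 0 <= gamma_kernel a x.
Proof. by rewrite /gamma_kernel; case: ifP => // _;
  rewrite mulr_ge0 ?powR_ge0 ?expR_ge0. Qed.

Lemma measurable_gamma_kernel a : measurable_fun setT (gamma_kernel a).
Proof.
apply: measurable_fun_gt0_if; apply: measurable_funM;
  first exact: measurable_powR.
exact: measurableT_comp.
Qed.

Lemma GammaE a : Gamma a = fine (\int[mu]_x (gamma_kernel a x)%:E)%E.
Proof.
rewrite /Gamma /Rintegral; congr fine.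
rewrite integral_mkcond; apply: eq_integral => x _.
by rewrite patchE mem_setE in_itv/= andbT /gamma_kernel; case: ifP.
Qed.

Lemma gamma_pdfE a x : gamma_pdf a x = gamma_kernel a x / Gamma a.
Proof.
rewrite /gamma_pdf patchE mem_setE in_itv/= andbT /gamma_kernel.
by case: ifP => // _; rewrite mul0r.
Qed.

Lemma Gamma_ge0 (a : R) : 0 <= Gamma a.
Proof.
rewrite GammaE; apply: fine_ge0; apply: integral_ge0 => x _.
by rewrite lee_fin gamma_kernel_ge0.
Qed.

(* [Gamma a] is [0] by convention when the integral diverges. *)
Lemma integral_gamma_kernel a : Gamma a != 0 ->
  (\int[mu]_x (gamma_kernel a x)%:E = (Gamma a)%:E)%E.
Proof.
rewrite GammaE; set I := (\int[mu]_x _)%E.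
have : (0 <= I)%E by apply: integral_ge0 => x _;
  rewrite lee_fin gamma_kernel_ge0.
by case: I => //=; rewrite eqxx.
Qed.

(* Both sides are iterated integrals of [a u^(a-1) e^(-t)] over [0 < u < t]. *)
Lemma integral_gamma_kernelS a : 0 < a ->
  (\int[mu]_x (gamma_kernel (a + 1) x)%:E =
   a%:E * \int[mu]_x (gamma_kernel a x)%:E)%E.
Proof.
move=> a0.
pose phi (z : R * R) : \bar R :=
  (if 0 < z.1 < z.2 then a * z.1 `^ (a - 1) * expR (- z.2) else 0)%:E.
have phi0 z : (0 <= phi z)%E.
  by rewrite lee_fin; case: ifP => // _;
    rewrite !mulr_ge0 ?powR_ge0 ?expR_ge0 ?ltW.
have mphi : measurable_fun setT phi.
  apply/measurable_EFinP; apply: measurable_fun_ifT => //.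
    by apply: measurable_and; apply: measurable_fun_ltr.
  apply: measurable_funM.
    apply: measurable_funM => //.
    by apply: (@measurableT_comp _ _ _ _ _ _ (@powR R ^~ (a - 1))) => //;
      exact: measurable_powR.
  by apply: measurableT_comp => //; apply: measurableT_comp.
have := fubini_tonelli (m1 := mu) (m2 := mu) phi mphi phi0.
rewrite [X in X = _ -> _](_ : _ = a%:E * \int[mu]_x (gamma_kernel a x)%:E)%E.
  move=> ->; apply: eq_integral => t _.
  rewrite /phi /gamma_kernel /=; have [t0|t0] := ltP 0 t.
    under eq_integral => u _.
      rewrite (_ : (if _ then _ else _)%:E = (expR (- t))%:E *
        (if 0 < u < t then a * u `^ (a - 1) else 0)%:E)%E.
        over.
      by case: ifP => _; rewrite -EFinM ?mulr0// mulrC.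
    rewrite ge0_integralZl//.
    - by rewrite integral_powR// -EFinM mulrC addrK.
    - apply/measurable_EFinP; apply: measurable_fun_ifT => //.
        by apply: measurable_and => //; apply: measurable_fun_ltr.
      by apply: measurable_funM => //; exact: measurable_powR.
    - by move=> u _; rewrite lee_fin; case: ifP => // _;
      rewrite mulr_ge0 ?powR_ge0 ?ltW.
  rewrite integral0_eq// => u _; case: ifP => // /andP[u0 ut].
  by have := lt_trans u0 ut; rewrite ltNge t0.
rewrite -ge0_integralZl//.
- apply: eq_integral => u _; rewrite /phi /gamma_kernel/=.
  have [u0|u0] := ltP 0 u; last by rewrite mule0 integral0_eq.
  under eq_integral => t _.
    rewrite (_ : (if _ then _ else _)%:E = (a * u `^ (a - 1))%:E *
      (if u < t then expR (- t) else 0)%:E)%E.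
      over.
    by rewrite /=; case: ifP => _; rewrite -EFinM ?mulr0.
  rewrite ge0_integralZl//.
  + by rewrite integral_expRN_tail -!EFinM mulrA.
  + apply/measurable_EFinP; apply: measurable_fun_ifT => //.
      exact: measurable_fun_ltr.
    exact: measurableT_comp.
  + by move=> t _; rewrite lee_fin; case: ifP => // _; rewrite expR_ge0.
  + by rewrite lee_fin mulr_ge0 ?powR_ge0 ?ltW.
- by apply/measurable_EFinP; exact: measurable_gamma_kernel.
- by move=> x _; rewrite lee_fin gamma_kernel_ge0.
- by rewrite lee_fin ltW.
Qed.

(** An infinite integral is not excluded beforehand: in that case [fine] sends both sides to 0. *)
Lemma GammaS a : 0 < a -> Gamma (a + 1) = a * Gamma a.
Proof.
move=> a0; rewrite !GammaE integral_gamma_kernelS//; set I := (\int[mu]_x _)%E.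
have : (0 <= I)%E by apply: integral_ge0 => x _;
  rewrite lee_fin gamma_kernel_ge0.
by case: I => //= _; rewrite gt0_muley ?lte_fin// mulr0.
Qed.

Lemma Gamma1 : @Gamma R 1 = 1.
Proof.
rewrite GammaE (_ : (\int[mu]_x _)%E = 1%E)//.
rewrite -[1%E]/(1%:E) -[in RHS](@expR0 R) -[in RHS]oppr0 -integral_expRN_tail.
by apply: eq_integral => x _; rewrite /gamma_kernel subrr powRr0 mul1r.
Qed.

Lemma pochhammerS a n : pochhammer a n.+1 = pochhammer a n * (a + n%:R).
Proof. by rewrite /pochhammer big_ord_recr. Qed.

Lemma Gamma_pochhammer a n : 0 < a ->
  Gamma (n%:R + a) = pochhammer a n * Gamma a.
Proof.
move=> a0; elim: n => [|n IHn];
  first by rewrite add0r /pochhammer big_ord0 mul1r.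
have a_n0 : 0 < n%:R + a by rewrite ltr_wpDl.
have -> : n.+1%:R + a = n%:R + a + 1 by rewrite -[n.+1]addn1 natrD addrAC.
by rewrite (GammaS a_n0) IHn pochhammerS mulrCA mulrA (addrC a).
Qed.

Lemma pochhammer1 n : @pochhammer R 1 n = n`!%:R.
Proof.
elim: n => [|n IHn]; first by rewrite /pochhammer big_ord0.
by rewrite /pochhammer big_ord_recr/= -/(pochhammer _ _) IHn factS natrM mulrC
  nat1r.
Qed.

Lemma Gamma_natS n : @Gamma R (n%:R + 1) = n`!%:R.
Proof. by rewrite Gamma_pochhammer// pochhammer1 Gamma1 mulr1. Qed.

(** Substituting c x in the gamma integral brings out c * c^(a-1), which cancels c^(-a). *)
Lemma integral_gamma_rate (a c : R) : 0 < c ->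
  (\int[mu]_x (if 0 < x then x `^ (a - 1) * expR (- (c * x)) else 0)%:E =
   (c `^ (- a))%:E * \int[mu]_x (gamma_kernel a x)%:E)%E.
Proof.
move=> c0.
rewrite (@ge0_integral_affine _ c 0 (fun x => (gamma_kernel a x)%:E))//;
  last 2 first.
- by apply/measurable_EFinP; exact: measurable_gamma_kernel.
- by move=> x; rewrite lee_fin gamma_kernel_ge0.
rewrite muleA -EFinM -ge0_integralZl//.
- apply: eq_integral => x _; rewrite addr0 /gamma_kernel pmulr_rgt0//.
  case: ifP => x0; last by rewrite mule0.
  rewrite -EFinM powRM ?ltW//; congr _%:E.
  have -> : c `^ (- a) * c = (c `^ (a - 1))^-1.
    by rewrite -powRN opprB -{2}(powRr1 (ltW c0)) -powRD ?(gt_eqF c0)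
      ?implybT// addrC.
  by rewrite !mulrA mulVf ?mul1r// gt_eqF// powR_gt0.
- apply/measurable_EFinP; apply: measurableT_comp;
  first exact: measurable_gamma_kernel.
  by apply: measurable_funD => //; apply: measurable_funM.
- by move=> x _; rewrite lee_fin gamma_kernel_ge0.
- by rewrite lee_fin mulr_ge0 ?powR_ge0// ltW.
Qed.

End gamma_function.

(** * Joint densities *)

Section integral_density.
Local Open Scope ereal_scope.
Context d (T : measurableType d) (R : realType).
Variables (m nu : {measure set T -> \bar R}) (f : T -> R).
Hypotheses (mf : measurable_fun setT f) (f0 : forall x, (0 <= f x)%R).
Hypothesis nuE : forall A, measurable A -> nu A = \int[m]_(x in A) (f x)%:E.

Import HBNNSimple.

(** Monotone convergence along simple functions reduces the claim to scaled indicators, where it is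
    [nuE]. *)
Lemma ge0_integral_density (phi : T -> \bar R) :
  measurable_fun setT phi -> (forall x, 0 <= phi x) ->
  \int[nu]_x phi x = \int[m]_x (phi x * (f x)%:E).
Proof.
move=> mphi phi0; pose h := nnsfun_approx measurableT mphi.
have cvgh x : (h n x)%:E @[n --> \oo] --> phi x.
  by apply: cvg_nnsfun_approx.
have mfE : measurable_fun setT (EFin \o f) by exact/measurable_EFinP.
transitivity (limn (fun n => \int[nu]_x (h n x)%:E)).
  rewrite -monotone_convergence//.
  - by apply: eq_integral => x _; apply/esym/cvg_lim => //; exact: cvgh.
  - by move=> n; exact/measurable_EFinP/measurable_funP.
  - by move=> n x _; rewrite lee_fin.
  - by move=> x _ i j ij; rewrite lee_fin; exact/lefP/nd_nnsfun_approx.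
transitivity (limn (fun n => \int[m]_x ((h n x)%:E * (f x)%:E))); last first.
  rewrite -monotone_convergence//.
  - apply: eq_integral => x _; apply/cvg_lim => //.
    by apply: cvgeZr => //; exact: cvgh.
  - move=> n; apply: emeasurable_funM => //.
    exact/measurable_EFinP/measurable_funP.
  - by move=> n x _; rewrite mule_ge0// lee_fin.
  - move=> x _ i j ij; apply: lee_wpmul2r; first by rewrite lee_fin.
    by rewrite lee_fin; exact/lefP/nd_nnsfun_approx.
congr (limn _); apply/funext => n.
have mhk (k : R) : measurable (h n @^-1` [set k]) by exact: measurable_sfunP.
transitivity (\sum_(k \in range (h n)) \int[nu]_x (k * \1_(h n @^-1` [set k])
  x)%:E).
  under eq_integral do rewrite fimfunE -fsumEFin//.
  rewrite ge0_integral_fsum//.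
  - by move=> k; exact/measurable_EFinP/measurable_funM.
  - by move=> k x _; rewrite nnfun_muleindic_ge0.
transitivity (\sum_(k \in range (h n))
    \int[m]_x ((k * \1_(h n @^-1` [set k]) x)%:E * (f x)%:E)); last first.
  rewrite -ge0_integral_fsum//.
  - apply: eq_integral => x _; rewrite [in RHS]fimfunE -fsumEFin//.
    rewrite ge0_mule_fsuml// => k; exact: nnfun_muleindic_ge0.
  - move=> k; apply: emeasurable_funM => //.
    by apply/measurable_EFinP/measurable_funM.
  - by move=> k x _; rewrite mule_ge0 ?nnfun_muleindic_ge0// lee_fin.
apply: eq_fsbigr => k /[!inE] -[x _ hxk].
have k0 : (0 <= k)%R by rewrite -hxk.
under [RHS]eq_integral do rewrite EFinM -muleA.
under [LHS]eq_integral do rewrite EFinM.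
rewrite !ge0_integralZl ?lee_fin//.
- congr (_ * _); rewrite integral_indic// setIT nuE// [LHS]integral_mkcond.
  by apply: eq_integral => y _; rewrite patchE indicE; case: ifP;
    rewrite ?mul1e ?mul0e.
- by apply: emeasurable_funM => //; exact/measurable_EFinP.
- by move=> y _; rewrite mule_ge0 ?lee_fin.
- exact/measurable_EFinP.
Qed.

End integral_density.

Section expectation_density.
Local Open Scope ereal_scope.
Context d (T : measurableType d) (R : realType) (P : probability T R).
Notation mu := (@lebesgue_measure R).

(* The carrier of [mu] and the codomain of [U] have the same measurable sets but
   different displays, whence the detour through [P]. *)
Lemma ge0_expectation_density (U : {RV P >-> R}) (f : R -> R)
    (phi : R -> \bar R) :
  has_density_on U setT f ->
  measurable_fun setT phi -> (forall x, 0 <= phi x) ->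
  \int[P]_w phi (U w) = \int[mu]_x (phi x * (f x)%:E).
Proof.
move=> [mf f0 Uf] mphi phi0.
have mU : measurable_fun setT (U : T -> measurableTypeR R).
  exact: (measurable_funPT U).
pose nu : {measure set (measurableTypeR R) -> \bar R} :=
  measure_function_pushforward__canonical__measure_function_Measure P mU.
have nuE (A : set (measurableTypeR R)) : measurable A ->
    nu A = \int[mu]_(x in A) (f x)%:E.
  by move=> mA; exact: Uf.
rewrite -(ge0_integral_density (m := mu) (nu := nu))//.
  by rewrite ge0_integral_pushforward// preimage_setT.
by move=> x; exact: (f0 x I).
Qed.

End expectation_density.

Section joint_density.
Local Open Scope ereal_scope.
Context d (T : measurableType d) (R : realType) (P : probability T R).
Notation mu := (@lebesgue_measure R).

Definition independent_pair (U V : {RV P >-> R}) : Prop :=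
  forall A B, measurable A -> measurable B ->
    P (U @^-1` A `&` V @^-1` B) = P (U @^-1` A) * P (V @^-1` B).

(** By independence the law of the pair agrees with the product of the marginals on rectangles,
    hence everywhere by uniqueness of the product measure. The marginals are then replaced by their
    densities one at a time. *)
Lemma joint_density (U V : {RV P >-> R}) (f g : R -> R) (C : set (R * R)) :
  independent_pair U V -> has_density_on U setT f -> has_density_on V setT g ->
  measurable C ->
  P ((fun w => (U w, V w)) @^-1` C) =
    \int[mu]_u \int[mu]_v (\1_C (u, v) * (f u * g v))%:E.
Proof.
move=> UV [mf f0 Uf] [mg g0 Vg] mC.
have {}f0 x : (0 <= f x)%R by exact: (f0 x I).
have {}g0 x : (0 <= g x)%R by exact: (g0 x I).
have mpair : measurable_fun setT (fun w => (U w, V w)).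
  exact: measurable_fun_pair.
pose m' : {measure set (R * R) -> \bar R} :=
  measure_function_pushforward__canonical__measure_function_Measure P mpair.
rewrite -[LHS]/(m' C).
rewrite -(product_measure_unique (m1 := distribution P U) (m2 := distribution P
  V))//.
rewrite /product_measure1/=.
rewrite ge0_integral_distribution//=; last exact: measurable_fun_xsection.
rewrite (ge0_expectation_density (U := U) (f := f)
  (phi := fun u => distribution P V (xsection C u)))//;
    last exact: measurable_fun_xsection.
apply: eq_integral => u _.
have mCu : measurable (xsection C u) by exact: measurable_xsection.
rewrite [distribution P V _]Vg// muleC -ge0_integralZl ?lee_fin ?f0//.
- rewrite [LHS]integral_mkcond; apply: eq_integral => v _.
  rewrite patchE /= mem_xsection indicE -EFinM; case: ifP => _.
    by rewrite mul1r.
  by rewrite mul0r.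
- by apply/measurable_EFinP; exact: measurable_funTS.
- by move=> v _; rewrite lee_fin g0.
Qed.

End joint_density.

Section density_operations.
Local Open Scope ereal_scope.
Context d (T : measurableType d) (R : realType) (P : probability T R).
Notation mu := (@lebesgue_measure R).
Variables (U V : {RV P >-> R}) (f g : R -> R).
Hypotheses (UV : independent_pair U V).
Hypotheses (Uf : has_density_on U setT f) (Vg : has_density_on V setT g).

Let mf : measurable_fun setT f. Proof. by case: Uf. Qed.
Let mg : measurable_fun setT g. Proof. by case: Vg. Qed.
Let f0 x : (0 <= f x)%R. Proof. by case: Uf => _ + _; apply. Qed.
Let g0 x : (0 <= g x)%R. Proof. by case: Vg => _ + _; apply. Qed.

Lemma measurable_fun_indic_comp d' (T' : measurableType d') (A : set R)
    (h : T' -> R) :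
  measurable A -> measurable_fun setT h ->
  measurable_fun setT (fun x => \1_A (h x) : R).
Proof.
move=> mA mh; apply: (@measurableT_comp _ _ _ _ _ _ (\1_A : R -> R)) => //.
Qed.

(** For fixed [u] the inner variable is translated to [t = u + v]; Tonelli then brings [t]
    outside. *)
Lemma density_add (A : set R) : measurable A ->
  P ((fun w => U w + V w)%R @^-1` A) =
    \int[mu]_(t in A) \int[mu]_u (f u * g (t - u))%:E.
Proof.
move=> mA.
pose C : set (R * R) := [set z | A (z.1 + z.2)%R].
have mC : measurable C.
  rewrite -[C]setTI;
    apply: (measurable_funD measurable_fst measurable_snd) => //.
rewrite -[LHS]/(P ((fun w => (U w, V w)) @^-1` C)) (joint_density UV Uf Vg mC).
pose phi (z : R * R) : \bar R := (\1_A z.2 * (f z.1 * g (z.2 - z.1)))%:E.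
have phi0 z : 0 <= phi z by rewrite lee_fin !mulr_ge0.
have mphi : measurable_fun setT phi.
  apply/measurable_EFinP; apply: measurable_funM.
    exact: measurable_fun_indic_comp.
  apply: measurable_funM; first exact: measurableT_comp.
  by apply: measurableT_comp => //; apply: measurable_funB.
transitivity (\int[mu]_u \int[mu]_t phi (u, t)).
  apply: eq_integral => u _.
  rewrite (@ge0_integral_affine _ 1 (- u))//.
  - rewrite mul1e; apply: eq_integral => t _; rewrite /phi/= mul1r.
    rewrite -[\1_C _]/(\1_A (u + (t - u))%R).
    by rewrite subrKC.
  - apply/measurable_EFinP; apply: measurable_funM.
      rewrite (_ : (fun x => _) = fun x => \1_A (u + x)%R) //.
      by apply: measurable_fun_indic_comp => //; apply: measurable_funD.
    by apply: measurable_funM.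
  - by move=> x; rewrite lee_fin !mulr_ge0.
rewrite (fubini_tonelli (m1 := mu) (m2 := mu) phi mphi phi0) [RHS]integral_mkcond.
apply: eq_integral => t _; rewrite patchE /phi /=.
case: ifPn => tA.
  by apply: eq_integral => u _; rewrite indicE tA mul1r.
by rewrite integral0_eq// => u _; rewrite indicE (negbTE tA) mul0r.
Qed.

(** For a fixed denominator [z] the numerator is [z / b * x], so [z / b] is the Jacobian. As [f]
    vanishes for [z <= 0], only positive scalings occur and the integrand stays nonnegative. *)
Lemma density_div (b : R) (A : set R) : (0 < b)%R ->
  (forall z, (z <= 0)%R -> f z = 0%R) -> measurable A ->
  P ((fun w => b * V w / U w)%R @^-1` A) =
    \int[mu]_(x in A) \int[mu]_z (z / b * (f z * g (z / b * x)))%:E.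
Proof.
move=> b0 fN mA.
pose C : set (R * R) := [set z | A (b * z.2 / z.1)%R].
have mC : measurable C.
  rewrite -[C]setTI.
  have : measurable_fun setT (fun z : R * R => b * z.2 / z.1)%R.
    apply: measurable_funM; first exact: measurable_funM.
    by apply: (@measurableT_comp _ _ _ _ _ _ (@GRing.inv R)) => //;
      exact: measurable_inv.
  exact.
rewrite -[LHS]/(P ((fun w => (U w, V w)) @^-1` C)) (joint_density UV Uf Vg mC).
pose phi (z : R * R) : \bar R :=
  (\1_A z.2 * (z.1 / b * (f z.1 * g (z.1 / b * z.2))))%:E.
have phi0 z : 0 <= phi z.
  rewrite lee_fin; have [z0|z0] := leP z.1 0%R;
    first by rewrite fN// mul0r !mulr0.
  by rewrite !mulr_ge0// ?invr_ge0 ltW.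
have mphi : measurable_fun setT phi.
  apply/measurable_EFinP; apply: measurable_funM.
    exact: measurable_fun_indic_comp.
  apply: measurable_funM; first exact: measurable_funM.
  apply: measurable_funM; first exact: measurableT_comp.
  by apply: measurableT_comp => //; apply: measurable_funM => //;
    apply: measurable_funM.
transitivity (\int[mu]_z \int[mu]_x phi (z, x)).
  apply: eq_integral => z _; have [z0|z0] := leP z 0%R.
    by rewrite !integral0_eq// => x _; rewrite /phi/= fN// mul0r !mulr0.
  have zb0 : (0 < z / b)%R by rewrite divr_gt0.
  rewrite (@ge0_integral_affine _ (z / b) 0)//.
  - rewrite -ge0_integralZl//.
    + apply: eq_integral => x _; rewrite /phi/= addr0 -EFinM; congr (_%:E).
      rewrite mulrCA; congr (_ * _)%R.
      rewrite -[\1_C _]/(\1_A (b * (z / b * x) / z)%R).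
      suff -> : (b * (z / b * x) / z = x)%R by [].
      by field; rewrite !gt_eqF.
    + apply/measurable_EFinP; apply: measurable_funM.
        rewrite (_ : (fun x => _) = fun x =>
          \1_A (b * (z / b * x + 0) / z)%R) //.
        apply: measurable_fun_indic_comp => //; apply: measurable_funM => //.
        by apply: measurable_funM => //; apply: measurable_funD => //;
          apply: measurable_funM.
      apply: measurable_funM => //; apply: measurableT_comp => //.
      by apply: measurable_funD => //; apply: measurable_funM.
    + by move=> x _; rewrite lee_fin !mulr_ge0.
    + by rewrite lee_fin ltW.
  - apply/measurable_EFinP; apply: measurable_funM.
      rewrite (_ : (fun x => _) = fun x => \1_A (b * x / z)%R) //.
      by apply: measurable_fun_indic_comp => //; apply: measurable_funM => //;
        apply: measurable_funM.
    by apply: measurable_funM.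
  - by move=> x; rewrite lee_fin !mulr_ge0.
rewrite (fubini_tonelli (m1 := mu) (m2 := mu) phi mphi phi0) [RHS]integral_mkcond.
apply: eq_integral => x _; rewrite patchE /phi /=.
case: ifPn => xA.
  by apply: eq_integral => z _; rewrite indicE xA mul1r.
by rewrite integral0_eq// => z _; rewrite indicE (negbTE xA) mul0r.
Qed.

End density_operations.

(** * Sums and quotients of gamma variables *)

Section gamma_laws.
Context d (T : measurableType d) (R : realType) (P : probability T R).
Notation mu := (@lebesgue_measure R).
Implicit Types a b beta : R.

Lemma gamma_pdf_ge0 a x : 0 <= gamma_pdf a x.
Proof. by rewrite gamma_pdfE divr_ge0 ?gamma_kernel_ge0 ?Gamma_ge0. Qed.

Lemma measurable_gamma_pdf a : measurable_fun setT (gamma_pdf a).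
Proof.
rewrite (_ : gamma_pdf a = fun x => gamma_kernel a x / Gamma a).
  by apply: measurable_funM => //; exact: measurable_gamma_kernel.
by apply/funext => x; exact: gamma_pdfE.
Qed.

(** If [Gamma a] were 0, the convention [0^-1 = 0] would make [gamma_pdf a] vanish identically,
    against total mass 1. *)
Lemma gamma_distributed_Gamma_gt0 a (U : {RV P >-> R}) :
  gamma_distributed a U -> 0 < Gamma a.
Proof.
move=> [_ _ /(_ setT measurableT (@subset_refl _ _)) UE].
rewrite lt_neqAle Gamma_ge0 andbT eq_sym; apply/eqP => Ga0.
move: UE; rewrite integral0_eq => [|x _];
  last by rewrite gamma_pdfE Ga0 invr0 mulr0.
by rewrite probability_setT => /eqP; rewrite gt_eqF.
Qed.

Lemma gamma_distributed_le0 a (U : {RV P >-> R}) :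
  gamma_distributed a U -> P (U @^-1` `]-oo, 0]) = 0%E.
Proof.
move=> [_ _ UE]; rewrite [LHS]UE// integral0_eq// => x.
rewrite /= in_itv/= gamma_pdfE /gamma_kernel => x0.
by rewrite ltNge x0/= mul0r.
Qed.

(** In the convolution with an exponential density the factors exp(-u) and exp(-(t-u)) multiply to
    exp(-t), so only u^(a-1) is left to integrate over (0, t). *)
Lemma gamma_distributed_add a (U V W : {RV P >-> R}) : 0 < a ->
  independent_pair U V -> gamma_distributed a U -> gamma_distributed 1 V ->
  (forall w, W w = U w + V w) -> gamma_distributed (a + 1) W.
Proof.
move=> a0 UV Ua V1 WE; have Ga := gamma_distributed_Gamma_gt0 Ua.
split; [exact: measurable_gamma_pdf|by move=> x _; exact: gamma_pdf_ge0|].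
move=> A mA _.
have -> : distribution P W A = P ((fun w => U w + V w) @^-1` A).
  by rewrite /distribution /pushforward; congr (P (_ @^-1` A)); apply/funext.
rewrite (density_add UV Ua V1 mA); apply: eq_integral => t _.
(* The division by [a] compensates the factor [a] in the integrand of [integral_powR]; together with
   [Gamma a] it becomes [Gamma (a + 1)]. *)
transitivity (\int[mu]_u ((expR (- t) / Gamma a / a)%:E *
    (if 0 < u < t then a * u `^ (a - 1) else 0)%:E))%E.
  apply: eq_integral => u _.
  rewrite !gamma_pdfE Gamma1 divr1 /gamma_kernel subr_gt0 -EFinM; congr _%:E.
  have [u0|] := ltP 0 u; last by rewrite !mul0r !mulr0.
  rewrite /=; case: ifP => _; last by rewrite !mulr0.
  rewrite subrr powRr0 mul1r.
  have -> : - t = - u + - (t - u) by ring.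
  by rewrite expRD; field; rewrite !gt_eqF.
rewrite ge0_integralZl//; last 3 first.
- apply/measurable_EFinP; apply: measurable_fun_ifT => //.
    by apply: measurable_and => //; apply: measurable_fun_ltr.
  by apply: measurable_funM => //; exact: measurable_powR.
- by move=> u _; rewrite lee_fin; case: ifP => // _;
  rewrite mulr_ge0 ?powR_ge0 ?ltW.
- by rewrite lee_fin !divr_ge0 ?expR_ge0 ?ltW.
rewrite gamma_pdfE /gamma_kernel; have [t0|t0] := ltP 0 t.
  rewrite integral_powR// -EFinM GammaS// addrK; congr _%:E.
  by field; rewrite !gt_eqF.
rewrite integral0_eq ?mule0 ?mul0r// => u _; case: ifP => // /andP[u0 ut].
by have := lt_trans u0 ut; rewrite ltNge t0.
Qed.

(** A density only for x > 0, but not cut off there: [powR] is nonnegative everywhere, so the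
    formula is nonnegative and measurable on the whole line. *)
Definition beta_prime_pdf a b beta (x : R) : R :=
  Gamma (a + b) / (Gamma a * Gamma b) *
    (x `^ (a - 1) * beta `^ (- a) * (1 + x / beta) `^ (- (a + b))).

(** At a fixed [x] the integrand over the denominator [z] is, up to a constant, a gamma integrand of
    parameter [a + b] and rate 1 + x/beta. *)
Lemma gamma_distributed_div a b beta (U V : {RV P >-> R}) (A : set R) :
  0 < a -> 0 < beta -> Gamma (a + b) != 0 ->
  independent_pair V U -> gamma_distributed a U -> gamma_distributed b V ->
  measurable A -> A `<=` `]0, +oo[ ->
  P ((fun w => beta * U w / V w) @^-1` A) =
    (\int[mu]_(x in A) (beta_prime_pdf a b beta x)%:E)%E.
Proof.
move=> a0 beta0 Gab VU Ua Vb mA A0.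
have Ga := gamma_distributed_Gamma_gt0 Ua.
have Gb := gamma_distributed_Gamma_gt0 Vb.
rewrite (density_div VU Vb Ua beta0)//; last first.
  by move=> z z0; rewrite gamma_pdfE /gamma_kernel ltNge z0 mul0r.
apply: eq_integral => x /[!inE] /A0 /=; rewrite in_itv/= andbT => x0.
have xb0 : 0 < 1 + x / beta by rewrite addr_gt0// divr_gt0.
set K := x `^ (a - 1) * beta `^ (- a) / (Gamma a * Gamma b).
transitivity (\int[mu]_z (K%:E * (if 0 < z
    then z `^ (a + b - 1) * expR (- ((1 + x / beta) * z)) else 0)%:E))%E.
  apply: eq_integral => z _; rewrite -EFinM; congr _%:E.
  rewrite !gamma_pdfE /gamma_kernel.
  have [z0|z0] := ltP 0 z; last by rewrite !(mul0r, mulr0).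
  have zb0 : 0 < z / beta by rewrite divr_gt0.
  rewrite mulr_gt0// /K.
  have -> : - ((1 + x / beta) * z) = - z + - (z / beta * x).
    by field; rewrite gt_eqF.
  have -> : a + b - 1 = a + (b - 1) by ring.
  rewrite expRD (@powRD _ z a (b - 1)) ?(gt_eqF z0) ?implybT//.
  rewrite (@powRM _ (z / beta)) ?ltW//.
  (* The Jacobian [z / beta] raises the exponent [a - 1] of the numerator density to [a]. *)
  have -> : z `^ a = (z / beta) * (z / beta) `^ (a - 1) * beta `^ a.
    by rewrite mulr_powRB1 ?(ltW zb0)// -powRM ?divfK ?gt_eqF// ltW.
  rewrite powRN; have ba0 := powR_gt0 a beta0; move: Ga Gb ba0.
  move: (Gamma a) (Gamma b) (beta `^ a) ((z / beta) `^ _) (z `^ _) (x `^ _).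
  move: (expR _) (expR _) => E1 E2 Ga Gb B c1 c2 c3 Ga0 Gb0 B0.
  by field; rewrite !gt_eqF.
rewrite ge0_integralZl//; last 3 first.
- apply/measurable_EFinP; apply: measurable_fun_gt0_if.
  apply: measurable_funM; first exact: measurable_powR.
  by apply: measurableT_comp => //; apply: measurableT_comp => //;
    apply: measurable_funM.
- by move=> z _; rewrite lee_fin; case: ifP => // _;
  rewrite mulr_ge0 ?powR_ge0 ?expR_ge0.
- by rewrite lee_fin; apply: divr_ge0; apply: mulr_ge0;
    rewrite ?powR_ge0 ?Gamma_ge0.
rewrite integral_gamma_rate// integral_gamma_kernel// -!EFinM; congr _%:E.
rewrite /K /beta_prime_pdf; move: (Gamma (a + b)) ((Gamma a * Gamma b)^-1) => g1 g2.
move: (x `^ _) (beta `^ _) ((1 + x / beta) `^ _) => c1 c2 c3.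
by ring.
Qed.

End gamma_laws.

(** * Independence of partial sums *)

Section independent_sums.
Local Open Scope ereal_scope.
Context d (T : measurableType d) (R : realType) (P : probability T R).

(** The sets [C] obeying the product rule form a Dynkin system containing the rectangles, which are
    stable under intersection. General [C] are needed because an event on [U + V] is not a
    rectangle. *)
Lemma independent_pair_event (U V : {RV P >-> R}) (E : set T) : measurable E ->
  (forall A B, measurable A -> measurable B ->
    P (U @^-1` A `&` V @^-1` B `&` E) = P (U @^-1` A `&` V @^-1` B) * P E) ->
  forall C : set (R * R), measurable C ->
    P ((fun w => (U w, V w)) @^-1` C `&` E) =
    P ((fun w => (U w, V w)) @^-1` C) * P E.
Proof.
move=> mE UVE; set h := fun w => (U w, V w).
have mh : measurable_fun setT h by exact: measurable_fun_pair.
have mhC C : measurable C -> measurable (h @^-1` C).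
  by move=> mC; rewrite -[_ @^-1` _]setTI; exact: mh.
rewrite measurable_prod_measurableType.
apply: dynkin_induction => /=.
- by rewrite measurable_prod_measurableType.
- move=> _ _ [A1 mA1 [A2 mA2 <-]] [B1 mB1 [B2 mB2 <-]].
  exists (A1 `&` B1); first exact: measurableI.
  exists (A2 `&` B2); first exact: measurableI.
  by rewrite setXI.
- by rewrite preimage_setT setTI probability_setT mul1e.
- by move=> _ [A mA [B mB <-]]; exact: UVE.
- move=> C mC CE; have -> : h @^-1` (~` C) = ~` (h @^-1` C) by [].
  rewrite (setIC _ E) -(setDE E (h @^-1` C)) measureD//; last 2 first.
  + exact: mhC.
  + by rewrite (le_lt_trans (probability_le1 P mE))// ltry.
  rewrite -[X in _ - P X]/(E `&` h @^-1` C) (setIC E) CE probability_setC;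
    last exact: mhC.
  by rewrite muleBl ?mul1e// fin_num_measure//; exact: mhC.
- move=> F mF tF FE.
  have thF : trivIset [set: nat] (fun n => h @^-1` F n).
    apply/trivIsetP => i j _ _ ij; rewrite -preimage_setI.
    by move/trivIsetP : tF => /(_ _ _ I I ij) ->; rewrite preimage_set0.
  rewrite preimage_bigcup setI_bigcupl measure_bigcup//; last 2 first.
    by move=> n _; apply: measurableI => //; exact: mhC.
    exact: trivIset_setIr.
  rewrite measure_bigcup//; last by move=> n _; exact: mhC.
  have PE : P E \is a fin_num by rewrite fin_num_measure.
  rewrite -[in RHS](fineK PE) muleC -nneseriesZl//.
  by apply: eq_eseriesr => n _; rewrite fineK// muleC; exact: FE.
Qed.

Lemma measurable_bigcap_preimage (I : eqType) (X : I ->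
  {RV P >-> R}) (s : seq I)
    (A : I -> set R) : (forall i, measurable (A i)) ->
  measurable (\bigcap_(i in [set` s]) X i @^-1` A i).
Proof.
move=> mA; apply: fin_bigcap_measurable => // i _.
exact: measurable_funPTI.
Qed.

Lemma bigcap_cons (I : eqType) (j : I) (s : seq I) (F : I -> set T) :
  \bigcap_(i in [set` j :: s]) F i = F j `&` \bigcap_(i in [set` s]) F i.
Proof.
apply/seteqP; split=> w /=.
  move=> Fw; split; first by apply: Fw; rewrite /= mem_head.
  by move=> i /= si; apply: Fw; rewrite /= inE si orbT.
by move=> [Fj Fs] i /=; rewrite inE => /predU1P[->//|]; exact: Fs.
Qed.

(** In the induction on [l], the new variable [X j] leaves the sum and joins the events indexed by
    [s]. The induction hypothesis then settles rectangles for the pair (sum over [l], [X j]), and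
    [independent_pair_event] extends this to the sum of the two. *)
Lemma mutually_independent_sum (I : eqType) (X : I -> {RV P >-> R})
    (l s : seq I) (A : I -> set R) (C : set R) :
  mutually_independent X -> uniq (l ++ s) ->
  (forall i, measurable (A i)) -> measurable C ->
  P ((\sum_(i <- l) X i)%R @^-1` C `&` \bigcap_(i in [set` s]) X i @^-1` A i) =
  P ((\sum_(i <- l) X i)%R @^-1` C) * P (\bigcap_(i in [set` s]) X i @^-1` A i).
Proof.
move=> indX; elim: l s A C => [|j l IHl] s A C.
  move=> _ mA mC; rewrite big_nil.
  have [C0|C0] := pselect (C 0%R).
    rewrite (_ : _ @^-1` C = setT) ?setTI ?probability_setT ?mul1e//.
    by apply/seteqP; split.
  rewrite (_ : _ @^-1` C = set0) ?set0I ?measure0 ?mul0e//.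
  by apply/seteqP; split.
rewrite /= mem_cat negb_or -andbA => /and3P[jl js uls] mA mC.
have mE := measurable_bigcap_preimage X s mA.
set E := \bigcap_(i in _) _ in mE *.
have ujs : uniq (j :: s) by move: uls; rewrite cat_uniq /= js => /and3P[].
have uljs : uniq (l ++ j :: s).
  by rewrite -cat1s uniq_catCA /= mem_cat negb_or jl js.
have ulj : uniq (l ++ [:: j]).
  by rewrite cats1 rcons_uniq jl; move: uls; rewrite cat_uniq => /and3P[].
pose C' : set (R * R) := [set z | C (z.1 + z.2)%R].
have mC' : measurable C'.
  by rewrite -[C']setTI; apply: (measurable_funD measurable_fst measurable_snd).
have SE : (\sum_(i <- j :: l) X i)%R @^-1` C =
    (fun w => ((\sum_(i <- l) X i)%R w, X j w)) @^-1` C'.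
  by rewrite big_cons; apply/seteqP; split => w; rewrite /C' /= addrC.
rewrite SE; apply: (independent_pair_event mE) => // A0 B mA0 mB.
(* One family for [j :: s]: it has [B] at [j] and still agrees with [A] on [s], since [j] is not in
   [s]. *)
pose A' i := if i == j then B else A i.
have mA' i : measurable (A' i) by rewrite /A'; case: ifP.
have cap_s : \bigcap_(i in [set` s]) X i @^-1` A' i = E.
  apply: eq_bigcapr => i /= si; rewrite /A'.
  by case: eqP => // ij; move: js; rewrite -ij si.
have := IHl (j :: s) A' A0 uljs mA' mA0.
have := IHl [:: j] A' A0 ulj mA' mA0.
rewrite !bigcap_cons cap_s set_nil bigcap_set0 setIT /A' eqxx.
move=> -> ; rewrite setIA => ->; rewrite -muleA; congr (_ * _).
have := indX (j :: s) A' ujs mA'.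
have := indX s A' _ mA'.
rewrite bigcap_cons cap_s big_cons /A' eqxx => -> //.
by case/andP: ujs.
Qed.

End independent_sums.

(** * The hypergeometric series *)

Section hypergeometric.
Context {R : realType}.
Implicit Types a b c z q : R.

Lemma is_cvg_series_ratio (u : R^nat) q M : (forall n, 0 <= u n) ->
  0 < q -> q < 1 -> (forall n, (M <= n)%N -> u n.+1 <= q * u n) ->
  cvgn (series u).
Proof.
move=> u0 q0 q1 uq.
(* For [i <= M] the sum dominates [u i] and [q ^+ i >= q ^+ M], so C q^i dominates [u i]; beyond [M]
   the ratio bound propagates this. *)
set C := (\sum_(i < M.+1) u i) / q ^+ M.
have leuC n : u n <= geometric C q n.
  have small i : (i <= M)%N -> u i <= C * q ^+ i.
    move=> iM; rewrite /C mulrAC ler_pdivlMr ?exprn_gt0//; apply: ler_pM => //.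
    - by rewrite exprn_ge0// ltW.
    - rewrite (bigD1 (Ordinal (iM : (i < M.+1)%N)))//= lerDl sumr_ge0//.
    - by rewrite ler_wiXn2l// ltW.
  rewrite /geometric /=; have [nM|/ltnW Mn] := leqP n M; first exact: small.
  elim: n Mn => [|n IHn]; first by rewrite leqn0 => /eqP M0; apply: small;
    rewrite M0.
  rewrite leq_eqVlt => /predU1P[<-|]; first exact: small.
  rewrite ltnS => Mn; rewrite (le_trans (uq n Mn))// exprS mulrCA ler_pM2l//.
  exact: IHn.
apply: (series_le_cvg u0 _ leuC) => [n|].
  exact: le_trans (u0 n) (leuC n).
by apply: is_cvg_geometric_series; rewrite ger0_norm// ltW.
Qed.

(** This shift is the origin of the parameters 1 + r, 1 + alpha and 2 and of the prefactor r alpha: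
    it is applied to (r)_(n+1), (alpha)_(n+1) and (1)_(n+1) = (n+1)!. *)
Lemma pochhammerSl a n : pochhammer a n.+1 = a * pochhammer (1 + a) n.
Proof.
rewrite /pochhammer big_ord_recl addr0; congr (_ * _).
by apply: eq_bigr => i _; rewrite /= /bump /= natrD addrA (addrC a).
Qed.

Lemma pochhammer_gt0 a n : 0 < a -> 0 < pochhammer a n.
Proof. by move=> a0; apply: prodr_gt0 => i _; rewrite ltr_pwDl. Qed.

Lemma pochhammer2 n : @pochhammer R 2 n = n.+1`!%:R.
Proof. by rewrite -pochhammer1 pochhammerSl mul1r. Qed.

Lemma hyp2F1_coeff_ge0 a b c z n : 0 < a -> 0 < b -> 0 < c -> 0 <= z ->
  0 <= hyp2F1_coeff a b c z n.
Proof.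
move=> a0 b0 c0 z0.
have poch (x : R) : 0 < x -> 0 <= pochhammer x n by move=> x0; apply: ltW;
  exact: pochhammer_gt0.
by apply: divr_ge0; rewrite !mulr_ge0 ?exprn_ge0 ?ler0n ?poch.
Qed.

Lemma is_cvg_hyp2F1 a b c z : 0 < a -> 0 < b -> 0 < c -> 0 <= z -> z < 1 ->
  cvgn (series (hyp2F1_coeff a b c z)).
Proof.
move=> a0 b0 c0 z0 z1.
pose q := (1 + z) / 2; have zq : z < q by rewrite /q; lra.
have q1 : q < 1 by rewrite /q; lra.
(* The term ratio tends to [z], and [q] is the midpoint of [z] and 1. With m = n >= 1 the
   lower-order part of (a+m)(b+m)z is at most (a+b+ab)m, which the surplus (q-z)m^2 absorbs once m >
   K. *)
pose K := (a + b + a * b) / (q - z).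
have qz : 0 < q - z by lra.
have K0 : 0 <= K by rewrite divr_ge0 ?ltW// !addr_gt0 ?mulr_gt0.
apply: (@is_cvg_series_ratio _ q (Num.truncn K).+1) => //.
- by move=> n; exact: hyp2F1_coeff_ge0.
- exact: le_lt_trans zq.
move=> n Kn.
have {}Kn : K < n%:R by rewrite (lt_le_trans (truncnS_gt K))// ler_nat.
have n1 : 1 <= n%:R :> R by rewrite ler1n lt0n; apply: contraTneq Kn => ->;
  rewrite -leNgt.
have cn : 0 < (c + n%:R) * n.+1%:R by rewrite mulr_gt0// addr_gt0//
  (lt_le_trans _ n1).
have -> : hyp2F1_coeff a b c z n.+1 = hyp2F1_coeff a b c z n *
    ((a + n%:R) * (b + n%:R) * z / ((c + n%:R) * n.+1%:R)).
  rewrite /hyp2F1_coeff !pochhammerS factS natrM exprSr; field.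
  by rewrite !gt_eqF ?ltr0n ?fact_gt0 ?pochhammer_gt0 ?addr_gt0// (lt_le_trans
    _ n1).
rewrite mulrC ler_wpM2r ?hyp2F1_coeff_ge0// ler_pdivrMr//.
rewrite -natr1; move: Kn; rewrite /K ltr_pdivrMr// => Kn.
set m := n%:R in n1 Kn *.
have m0 : 0 <= m by lra.
have q0 : 0 <= q by lra.
have h1 : a * b * z <= a * b * m.
  by apply: ler_wpM2l; [rewrite mulr_ge0// ltW|lra].
have h2 : (a + b) * m * z <= (a + b) * m * 1.
  by apply: ler_wpM2l; [rewrite mulr_ge0// ltW// addr_gt0|lra].
have h3 : (a + b + a * b) * m <= (m * (q - z)) * m.
  by apply: ler_wpM2r => //; exact: ltW.
have h4 : 0 <= q * (c * m + c + m).
  by rewrite mulr_ge0// !addr_ge0 ?mulr_ge0// ltW.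
lra.
Qed.

Lemma hyp2F1_eseries a b c z : 0 < a -> 0 < b -> 0 < c -> 0 <= z -> z < 1 ->
  (\sum_(n <oo) (hyp2F1_coeff a b c z n)%:E = (hyp2F1 a b c z)%:E)%E.
Proof.
move=> a0 b0 c0 z0 z1; rewrite /hyp2F1 -EFin_lim; last exact: is_cvg_hyp2F1.
by congr (limn _); apply/funext => n /=; rewrite sumEFin.
Qed.

Lemma hyp2F1_ge0 a b c z : 0 < a -> 0 < b -> 0 < c -> 0 <= z -> z < 1 ->
  0 <= hyp2F1 a b c z.
Proof.
move=> a0 b0 c0 z0 z1; rewrite -lee_fin -hyp2F1_eseries//.
by apply: nneseries_ge0 => n _ _; rewrite lee_fin hyp2F1_coeff_ge0.
Qed.

(** The gamma quotients reduce to (r)_(n+1) (alpha)_(n+1) / ((n+1)! n!). Of the powers, n copies of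
    1 - p, x/beta and 1/(1 + x/beta) form z^n, and what is left goes into the prefactor. *)
Lemma negbin_beta_prime (alpha beta r p x : R) n :
  0 < alpha -> 0 < beta -> 0 < r -> 0 < x -> Gamma alpha != 0 -> Gamma r != 0 ->
  negbin_pmf r p n.+1 * beta_prime_pdf n.+1%:R alpha beta x =
  r * alpha * (1 - p) * p `^ r / (beta * (1 + x / beta) `^ (alpha + 1)) *
    hyp2F1_coeff (1 + r) (1 + alpha) 2 ((1 - p) * (x / beta) / (1 + x / beta))
      n.
Proof.
move=> a0 b0 r0 x0 Ga Gr.
have w0 : 0 < 1 + x / beta by rewrite addr_gt0// divr_gt0.
set w := 1 + x / beta in w0 *.
rewrite /negbin_pmf /beta_prime_pdf /hyp2F1_coeff.
rewrite (Gamma_pochhammer _ r0) (Gamma_pochhammer _ a0) Gamma_natS.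
have -> : Gamma n.+1%:R = n`!%:R :> R by rewrite -natr1 Gamma_natS.
rewrite !(@pochhammerSl _ n) pochhammer2.
have -> : x `^ (n.+1%:R - 1) = x ^+ n by rewrite -natr1 addrK powR_mulrn// ltW.
have -> : beta `^ (- n.+1%:R) = (beta ^+ n * beta)^-1 by rewrite powR_invn
  ?ltW// exprSr.
have -> : w `^ (- (n.+1%:R + alpha)) = (w ^+ n * w * w `^ alpha)^-1.
  by rewrite powRN powRD ?(gt_eqF w0) ?implybT// powR_mulrn ?ltW// exprSr.
have -> : w `^ (alpha + 1) = w `^ alpha * w.
  by rewrite powRD ?(gt_eqF w0) ?implybT// powRr1// ltW.
rewrite !exprMn !exprVn exprSr.
have wa0 := powR_gt0 alpha w0.
have fS : (n.+1`!%:R : R) != 0 by rewrite gt_eqF// ltr0n fact_gt0.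
have fn : (n`!%:R : R) != 0 by rewrite gt_eqF// ltr0n fact_gt0.
move: Ga Gr wa0 fS fn; move: (Gamma alpha) (Gamma r) (w `^ _) (p `^ _).
move: (pochhammer _ _) (pochhammer _ _) (n.+1`!%:R : R) (n`!%:R : R).
move=> q1 q2 q3 q4 g1 g2 c1 c2 Ga Gr wa0 fS fn; field.
by rewrite fS fn Ga Gr !gt_eqF// ?exprn_gt0.
Qed.

End hypergeometric.

(** * The random sum *)

Lemma nneseries_recS (R : realType) (f : nat -> \bar R) :
  (forall n, 0 <= f n)%E ->
  (\sum_(n <oo) f n = f 0%N + \sum_(n <oo) f n.+1)%E.
Proof.
move=> f0; rewrite nneseries_recl// -[in LHS](nneseries_addn 1)//.
by congr (_ + _)%E; apply: eq_eseriesr => n _; rewrite addn1.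
Qed.

Section random_sum_law.
Context d (T : measurableType d) (R : realType) (P : probability T R).

Lemma measurable_partial_sum (X : nat -> {RV P >-> R}) n :
  measurable_fun setT (fun w => \sum_(i < n) X i w).
Proof. by apply: measurable_sum. Qed.

(** Once [T] is equipped with the generated sigma-algebra, each [X i] is measurable by construction,
    hence so are finite sums. *)
Lemma sigma_family_partial_sum (X : nat -> {RV P >-> R}) n (A : set R) :
  measurable A -> sigma_family X ((fun w => \sum_(i < n) X i w) @^-1` A).
Proof.
move=> mA; rewrite /sigma_family; set G := \bigcup_(i in _) _.
have mX i : measurable_fun setT (X i : g_sigma_algebraType G -> R).
  move=> _ B mB; apply: sub_sigma_algebra; exists i => //=.
  by exists B.
have : measurable_fun setT (fun w : g_sigma_algebraType G =>
  \sum_(i < n) X i w).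
  by apply: measurable_sum => i; exact: mX.
by move=> /(_ measurableT _ mA); rewrite setTI.
Qed.

Lemma random_sum_mixture (N : {RV P >-> nat}) (X : nat ->
  {RV P >-> R}) (A : set R) :
  independent_of_family N X -> measurable A ->
  (P (random_sum N X @^-1` A) = \sum_(n <oo)
     (P (N @^-1` [set n]) * P ((fun w => (\sum_(i < n) X i w)%R) @^-1` A)))%E.
Proof.
move=> NX mA.
have -> : random_sum N X @^-1` A = \bigcup_n (N @^-1` [set n] `&`
    (fun w => \sum_(i < n) X i w) @^-1` A).
  apply/seteqP; split => [w Aw|w [n _ [/= <-]]//].
  by exists (N w).
rewrite measure_semi_bigcup.
- by apply: eq_eseriesr => n _; apply: NX => //;
  exact: sigma_family_partial_sum.
- move=> n; apply: measurableI; first exact: measurable_funPTI.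
  by rewrite -[_ @^-1` A]setTI; exact: measurable_partial_sum.
- by apply: trivIset_setIr; exact: trivIset_preimage1.
- apply: bigcup_measurable => n _; apply: measurableI;
  first exact: measurable_funPTI.
  by rewrite -[_ @^-1` A]setTI; exact: measurable_partial_sum.
Qed.

(** With [Gamma r = 0] every mass would be 0, again by [0^-1 = 0], although the events [N = n] cover
    a space of mass 1. *)
Lemma negbin_Gamma_neq0 (N : {RV P >-> nat}) (r p : R) :
  (forall n, distribution P N [set n] = (negbin_pmf r p n)%:E) -> Gamma r != 0.
Proof.
move=> NE; apply/eqP => Gr0.
have : P setT = 0%E.
  have -> : [set: T] = \bigcup_n (N @^-1` [set n]).
    by apply/seteqP; split => // w _; exists (N w).
  rewrite measure_semi_bigcup; last 3 first.
  - by move=> n; exact: measurable_funPTI.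
  - exact: trivIset_preimage1.
  - by apply: bigcup_measurable => n _; exact: measurable_funPTI.
  apply: eseries0 => n _ _; rewrite -[LHS]/(distribution P N [set n]) NE.
  by rewrite /negbin_pmf Gr0 mulr0 invr0 mulr0 !mul0r.
by rewrite probability_setT => /eqP; rewrite onee_eq0.
Qed.

End random_sum_law.

(** * Partial sums of ratios with a common gamma denominator *)

Section gamma_ratio_sums.
Context d (T : measurableType d) (R : realType) (P : probability T R).
Variables (alpha beta : R) (Yalpha : {RV P >-> R}) (Y : nat -> {RV P >-> R}).
Hypotheses (alpha0 : 0 < alpha) (beta0 : 0 < beta).
Hypothesis Yalpha_gamma : gamma_distributed alpha Yalpha.
Hypothesis Y_gamma : forall i, gamma_distributed 1 (Y i).
Let F (o : option nat) : {RV P >-> R} := if o is Some i then Y i else Yalpha.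
Hypothesis F_indep : mutually_independent F.

(** Summing over a list of indices of [F] matches [mutually_independent_sum], which then separates
    [G n] both from the next numerator and from the denominator, at index [None]. *)
Let G n : {RV P >-> R} := \sum_(o <- map Some (iota 0 n)) F o.

Let GE n w : G n w = \sum_(i < n) Y i w.
Proof. by rewrite /G mfun_sum big_map -(big_mkord xpredT (fun i =>
  Y i w)) /index_iota subn0. Qed.

Let G_indep n o : o \notin map Some (iota 0 n) -> independent_pair (G n) (F o).
Proof.
move=> on A B mA mB.
have := @mutually_independent_sum _ _ _ P _ F (map Some (iota 0 n)) [:: o]
  (fun=> B) A F_indep.
rewrite set_cons1 bigcap_set1; apply => //.
by rewrite cats1 rcons_uniq on map_inj_uniq ?iota_uniq//; exact: Some_inj.
Qed.

Let G_gamma n : gamma_distributed n.+1%:R (G n.+1).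
Proof.
elim: n => [|n IHn]; first by rewrite /G /= big_seq1; exact: Y_gamma.
have -> : n.+2%:R = n.+1%:R + 1 :> R by rewrite natr1.
have GY : independent_pair (G n.+1) (Y n.+1).
  apply: (@G_indep n.+1 (Some n.+1)).
  by rewrite mem_map ?mem_iota ?ltnn//; exact: Some_inj.
apply: (gamma_distributed_add _ GY IHn (Y_gamma n.+1)) => // w.
by rewrite !GE big_ord_recr.
Qed.

Let X i := scaled_ratio beta (Y i) Yalpha.

(** Factoring out the common denominator turns a sum of dependent terms into one quotient of
    independent variables. *)
Let XE n : (fun w => \sum_(i < n) X i w) = (fun w => beta * G n w / Yalpha w).
Proof. by apply/funext => w; rewrite GE mulr_sumr mulr_suml. Qed.

Lemma prob_sum_scaled_ratio n (A : set R) : measurable A -> A `<=` `]0, +oo[ ->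
  P ((fun w => \sum_(i < n.+1) X i w) @^-1` A) =
    (\int[lebesgue_measure]_(x in A) (beta_prime_pdf n.+1%:R alpha beta
      x)%:E)%E.
Proof.
move=> mA A0; rewrite (XE n.+1).
have Gna : Gamma (n.+1%:R + alpha) != 0.
  rewrite Gamma_pochhammer// mulf_neq0// gt_eqF// ?pochhammer_gt0//.
  exact: gamma_distributed_Gamma_gt0 Yalpha_gamma.
have ZG : independent_pair Yalpha (G n.+1).
  move=> B C mB mC; rewrite setIC muleC; apply: (@G_indep n.+1 None) => //.
  by apply/mapP => -[].
have n0 : 0 < n.+1%:R :> R by rewrite ltr0n.
exact: (gamma_distributed_div n0 beta0 Gna ZG (G_gamma n) Yalpha_gamma).
Qed.

(** The quotient is 0 where the numerator is or, since [0^-1 = 0], where the denominator is. Both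
    events are null because gamma variables are almost surely positive. *)
Lemma prob_sum_scaled_ratio0 n :
  P ((fun w => \sum_(i < n.+1) X i w) @^-1` [set 0]) = 0%E.
Proof.
rewrite (XE n.+1); apply/eqP; rewrite eq_le measure_ge0 andbT.
set B : set R := `]-oo, 0]%classic.
have mB : measurable B by exact: measurable_itv.
have mN (U : {RV P >-> R}) : measurable (U @^-1` B) by exact: measurable_funPTI.
have sub : (fun w => beta * G n.+1 w / Yalpha w) @^-1` [set 0] `<=`
    G n.+1 @^-1` B `|` Yalpha @^-1` B.
  move=> w /= /eqP; rewrite !mulf_eq0 (gt_eqF beta0)/= invr_eq0.
  by case/orP => /eqP E0; [left|right]; rewrite /B /= in_itv/= E0.
apply: (@le_trans _ _ (P (G n.+1 @^-1` B `|` Yalpha @^-1` B))).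
  apply: le_measure => //; rewrite inE.
    rewrite -(XE n.+1) -[X in measurable X]setTI.
    by apply: (@measurable_partial_sum _ _ _ P X n.+1).
  exact: measurableU.
apply: le_trans (measureU2 _ _ _) _ => //.
rewrite [X in (X + _)%E](_ : _ = 0%E);
  last exact: gamma_distributed_le0 (G_gamma n).
rewrite [X in (_ + X)%E](_ : _ = 0%E);
  last exact: gamma_distributed_le0 Yalpha_gamma.
by rewrite adde0.
Qed.

End gamma_ratio_sums.

Theorem theorem4 (R : realType) (d : measure_display) (T : measurableType d)
    (P : probability T R) (alpha beta r p : R)
    (Yalpha : {RV P >-> R}) (Y : nat -> {RV P >-> R}) (N : {RV P >-> nat}) :
  0 < alpha -> 0 < beta -> 0 < r -> 0 < p -> p < 1 ->
  gamma_distributed alpha Yalpha ->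
  (forall i, gamma_distributed 1 (Y i)) ->
  mutually_independent (fun o : option nat => if o is Some i then Y i else Yalpha) ->
  (forall n, distribution P N [set n] = (negbin_pmf r p n)%:E) ->
  let X (i : nat) : {RV P >-> R} := scaled_ratio beta (Y i) Yalpha in
  independent_of_family N X ->
  let S : {RV P >-> R} := random_sum N X in
  distribution P S [set 0] = (p `^ r)%:E /\
  has_density_on S `]0, +oo[
    (fun x => r * alpha * (1 - p) * p `^ r / (beta * (1 + x / beta) `^ (alpha + 1))
       * hyp2F1 (1 + r) (1 + alpha) 2 ((1 - p) * (x / beta) / (1 + x / beta))).
Proof.
move=> alpha0 beta0 r0 p0 p1 Za Y1 indep NE X NX S.
have Gr := negbin_Gamma_neq0 NE.
have Ga : Gamma alpha != 0 by rewrite gt_eqF// (gamma_distributed_Gamma_gt0 Za).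
have mix A : measurable A -> (distribution P S A = \sum_(n <oo)
    ((negbin_pmf r p n)%:E * P ((fun w => (\sum_(i < n) X i w)%R) @^-1` A)))%E.
  move=> mA; rewrite [LHS](random_sum_mixture NX mA).
  by apply: eq_eseriesr => n _; rewrite -NE.
have pmf0 n : 0 <= negbin_pmf r p n by rewrite -lee_fin -NE.
split.
  rewrite mix// nneseries_recS; last by move=> n; rewrite mule_ge0// lee_fin.
  (* Sums with at least one term do not charge 0, so the atom is exactly the mass of [N = 0]. *)
  rewrite [X in (_ + X)%E](_ : _ = 0%E) ?adde0; last first.
    apply: eseries0 => n _ _.
    by rewrite (prob_sum_scaled_ratio0 beta0 Za Y1 indep) mule0.
  rewrite (_ : _ @^-1` _ = setT); last first.
    by apply/seteqP; split => // w _ /=; rewrite big_ord0.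
  rewrite probability_setT mule1 /negbin_pmf !add0r Gamma1 mul1r (divff Gr) mul1r.
  by rewrite expr0 mulr1.
set f := fun x : R => _.
pose z x := (1 - p) * (x / beta) / (1 + x / beta).
pose K x := r * alpha * (1 - p) * p `^ r / (beta * (1 + x / beta) `^ (alpha +
  1)).
(* The contribution of [N = n.+1] to the density; [N = 0] contributes only to the atom. *)
pose h n x := negbin_pmf r p n.+1 * beta_prime_pdf n.+1%:R alpha beta x.
have z01 x : 0 < x -> 0 <= z x < 1.
  move=> x0; have xb : 0 < x / beta by rewrite divr_gt0.
  have w0 : 0 < 1 + x / beta by rewrite addr_gt0.
  have pxb := mulr_gt0 p0 xb.
  apply/andP; split; last first.
    rewrite /z ltr_pdivrMr// mul1r mulrBl mul1r (@lt_trans _ _ (x / beta))//.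
      by rewrite ltrBlDr ltrDl.
    by rewrite ltrDr.
  by rewrite /z divr_ge0// ?(ltW w0)// mulr_ge0 ?(ltW xb)// subr_ge0 ltW.
have K0 x : 0 < x -> 0 <= K x.
  move=> x0; rewrite /K divr_ge0 ?mulr_ge0 ?powR_ge0// ?subr_ge0; exact: ltW.
have fE x : 0 < x -> (f x)%:E = (\sum_(n <oo) (h n x)%:E)%E.
  move=> x0; have /andP[z0 z1] := z01 x x0.
  under eq_eseriesr do rewrite /h negbin_beta_prime// EFinM.
  rewrite nneseriesZl//; last first.
    by move=> n _; rewrite lee_fin hyp2F1_coeff_ge0// addr_gt0.
  by rewrite hyp2F1_eseries// addr_gt0.
pose b n := beta_prime_pdf n.+1%:R alpha beta.
have mb n : measurable_fun setT (b n).
  apply: measurable_funM => //.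
  apply: measurable_funM; first (apply: measurable_funM => //;
    exact: measurable_powR).
  apply: (@measurableT_comp _ _ _ _ _ _ (@powR R ^~ (- (n.+1%:R + alpha)))).
    exact: measurable_powR.
  by apply: measurable_funD => //; apply: measurable_funM.
have mh n : measurable_fun setT (h n) by apply: measurable_funM => //;
  exact: mb.
have b0 n x : 0 <= b n x.
  by rewrite /b /beta_prime_pdf !mulr_ge0 ?powR_ge0 ?invr_ge0 ?mulr_ge0
    ?Gamma_ge0.
have h0 n x : 0 <= h n x by rewrite /h mulr_ge0// b0.
split.
(* Since [hyp2F1] is a limit, measurability is obtained from the series of the measurable [h n]. *)
- apply/measurable_EFinP; apply: (@eq_measurable_fun _ _ _ _ _
    (fun x => \sum_(n <oo) (h n x)%:E)%E).
    by move=> x /[!inE] /=; rewrite in_itv/= andbT => x0; rewrite fE.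
  apply: ge0_emeasurable_sum => n.
  + by move=> x _ _; rewrite lee_fin.
  + by move=> _; apply/measurable_EFinP; exact: measurable_funTS.
- move=> x /=; rewrite in_itv/= andbT => x0; have /andP[z0 z1] := z01 x x0.
  by rewrite /f mulr_ge0 ?K0// hyp2F1_ge0// addr_gt0.
move=> A mA A0.
rewrite mix// nneseries_recS; last by move=> n; rewrite mule_ge0// lee_fin.
(* The empty sum is 0, which lies outside [A], so the term [N = 0] drops out. *)
rewrite [X in (X + _)%E](_ : _ = 0%E) ?add0e; last first.
  rewrite (_ : _ @^-1` _ = set0) ?measure0 ?mule0//.
  apply/seteqP; split => // w /=; rewrite big_ord0 => /A0/=.
  by rewrite in_itv/= ltxx.
rewrite [RHS](_ : _ = \int[lebesgue_measure]_(x in A) (\sum_(n <oo) (h n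
  x)%:E))%E; last first.
  apply: eq_integral => x /[!inE] /A0/=; rewrite in_itv/= andbT; exact: fE.
rewrite integral_nneseries//; last 2 first.
- by move=> n; apply/measurable_EFinP;
  apply: (@measurable_funTS _ _ _ _ _ (h n)); exact: mh.
- by move=> n x _; rewrite lee_fin.
apply: eq_eseriesr => n _.
rewrite (prob_sum_scaled_ratio alpha0 beta0 Za Y1 indep n mA A0).
rewrite -ge0_integralZl ?lee_fin//.
- by apply/measurable_EFinP; apply: (@measurable_funTS _ _ _ _ _ (b n));
  exact: mb.
- by move=> x _; rewrite lee_fin; exact: b0.
Qed.
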